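(* Let $L$ be an oriented non-split alternating link and let $\overline A_B$ and $\overline A_W$ be the weighted adjacency matrices of its consolidated Tait graphs $G_B^*$ and $G_W^*$. Then $$CWR_5(L)=\bigl(\Phi_5(\overline A_B),\,\Phi_5(\overline A_W)\bigr),$$ where for a symmetric zero-diagonal matrix $M=(m_{ij})$ $$\Phi_5(M)=\frac1{10}\Bigl[\operatorname{tr}(M^5)-5\,\operatorname{tr}\bigl(\Delta(M)M^3\bigr)+5\,\operatorname{tr}\bigl(M^{\circ3}M^2\bigr)\Bigr].$$ Equivalently, in entries, $$\Phi_5(M)=\frac1{10}\left[\operatorname{tr}(M^5)-5\sum_i\Bigl(\sum_jm_{ij}^2\Bigr)(M^3)_{ii}+5\sum_{i,j}m_{ij}^3(M^2)_{ij}\right].$$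
   Context: $M^{\circ3}$ is the entrywise (Hadamard) cube of $M$, and $\Delta(M)$ is the diagonal matrix with $\Delta(M)_{ii}=\sum_jm_{ij}^2$. Tait graphs and $CWR$. Let $D$ be a reduced (no nugatory crossings) alternating diagram of an oriented non-split alternating link $L$. The regions of $D$ are checkerboard coloured black and white, so that regions sharing an edge have opposite colours; which class is called black is fixed once and for all by a local rule depending on the over/under pattern at crossings, the same rule for all diagrams (the statement holds for either choice of rule). The Tait graph $G_B$ has one vertex for each black region and one edge for each crossing, joining the black regions meeting at that crossing; $G_W$ is defined in the same way from white regions. Each edge $e$ gets weight $\operatorname{wg}(e)=w$ if the crossing is positive and $r$ if it is negative, where $w,r$ are commuting indeterminates. The consolidated Tait graph $G_B^*$ is the weighted simple graph obtained from $G_B$ by replacing all parallel edges joining the same pair of vertices by a single edge whose weight is the product of their weights; $G_W^*$ is obtained from $G_W$ likewise. For $i>2$, $CB_i(w,r)=\sum_C\prod_{e\in E(C)}\operatorname{wg}(e)$, summed over all unoriented simple cycles $C$ of length $i$ in $G_B^*$; $CW_i$ is defined analogously from $G_W^*$; and $CWR_i=(CB_i,CW_i)$. It is a known theorem that $CWR_i$ does not depend on the chosen reduced alternating diagram $D$ of $L$; $CWR_i(L)$ denotes the common value. The weighted adjacency matrix of a simple loopless weighted graph has $(i,j)$ entry equal to the weight of the edge $v_iv_j$ if it exists, and $0$ otherwise. *)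

(* Defs.v *)
From HB Require Import structures.
From mathcomp Require Import all_boot all_order all_algebra.
From mathcomp Require Import finmap.
From mathcomp Require Import all_classical all_reals all_analysis.
(* The notations of mpoly cannot be parsed together with those of analysis. *)
From mathcomp Require Import (canonicals, coercions) mpoly.

Set Implicit Arguments.
Unset Strict Implicit.
Unset Printing Implicit Defensive.

Import Order.TTheory GRing.Theory Num.Theory.
Import numFieldNormedType.Exports.

Local Open Scope classical_set_scope.
Local Open Scope ring_scope.

(** * Weighted graphs *)

(* Rational coefficients, because of the factor 1/10 in [Phi5]; the cycle sums
   themselves only involve integers. *)
Definition Qwr : comAlgType rat := mpoly.mpoly 2 rat.
Definition w : Qwr := mpoly.mpolyX rat (mpoly.mnm1 (0 : 'I_2)).
Definition r : Qwr := mpoly.mpolyX rat (mpoly.mnm1 (1 : 'I_2)).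

(* A multigraph: the edge x joins the elements of [mg_ends x], a set with two
   elements, or with one element if x is a loop. *)
Record wmultigraph (V : finType) (K : comNzRingType) := WMultigraph {
  mg_edge : choiceType;
  mg_edges : set mg_edge;
  mg_ends : mg_edge -> {set V};
  mg_weight : mg_edge -> K }.
Arguments mg_edges {V K} _.
Arguments mg_ends {V K} _.
Arguments mg_weight {V K} _.

(* A simple loopless graph: an edge is a set of two vertices. *)
Record wgraph (V : finType) (K : comNzRingType) := WGraph {
  sg_edges : {set {set V}};
  sg_weight : {set V} -> K;
  sg_edgesP : forall e, e \in sg_edges -> #|e| = 2%N }.
Arguments sg_edges {V K} _.
Arguments sg_weight {V K} _.

Section Consolidation.
Variables (V : finType) (K : comNzRingType) (G : wmultigraph V K).

Definition consolidated_edges : {set {set V}} :=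
  finset (fun e : {set V} =>
    (#|e| == 2%N) && `[< exists2 x, mg_edges G x & mg_ends G x = e >]).

Definition consolidated_weight (e : {set V}) : K :=
  \big[*%R/1]_(x \in [set x | mg_edges G x /\ mg_ends G x = e]) mg_weight G x.

Lemma consolidated_edgesP e : e \in consolidated_edges -> #|e| = 2%N.
Proof. by rewrite inE => /andP[/eqP]. Qed.

Definition consolidated : wgraph V K :=
  WGraph consolidated_weight consolidated_edgesP.

End Consolidation.

Section Graph.
Variables (V : finType) (K : comNzRingType) (G : wgraph V K).

Definition adjacent : rel V := fun x y => [set x; y]%SET \in sg_edges G.

Definition adjmx : 'M[K]_#|V| :=
  \matrix_(i, j) if adjacent (enum_val i) (enum_val j)
                 then sg_weight G [set enum_val i; enum_val j]%SET else 0.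

Definition cycle_edges (s : seq V) : {set {set V}} :=
  [set [set x; next s x]%SET | x in s]%SET.

(* For 2 < k, an unoriented simple cycle of length k is determined by its set
   of edges, whereas it has 2 * k vertex sequences. *)
Definition simple_cycles (k : nat) : {set {set {set V}}} :=
  finset (fun C => [exists s : k.-tuple V,
    [&& uniq s, cycle adjacent s & C == cycle_edges s]]).

Definition cycle_sum (k : nat) : K :=
  \sum_(C in simple_cycles k) \prod_(e in C) sg_weight G e.

End Graph.

(** * The polynomial Phi_5 *)

Definition hadamard_cube (K : comNzRingType) n (M : 'M[K]_n) : 'M[K]_n :=
  \matrix_(i, j) M i j ^+ 3.

Definition Delta (K : comNzRingType) n (M : 'M[K]_n) : 'M[K]_n :=
  diag_mx (\row_i \sum_j M i j ^+ 2).

Definition Phi5 (K : comAlgType rat) n (M : 'M[K]_n) : K :=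
  (10%:R^-1 : rat) *:
    (\tr (M ^+ 5) - 5%:R * \tr (Delta M *m M ^+ 3)
     + 5%:R * \tr (hadamard_cube M *m M ^+ 2)).

Definition Phi5_entries (K : comAlgType rat) n (M : 'M[K]_n) : K :=
  (10%:R^-1 : rat) *:
    (\tr (M ^+ 5) - 5%:R * \sum_i (\sum_j M i j ^+ 2) * (M ^+ 3) i i
     + 5%:R * \sum_i \sum_j M i j ^+ 3 * (M ^+ 2) i j).

(** * Links *)

Section Curves.
Variable R : realType.

Definition smooth m (f : R -> 'rV[R]_m.+1) : Prop :=
  forall k t, derivable (derive1n k f) t 1.

(* A smooth embedding of the oriented circle R / Z. *)
Definition closed_curve m (f : R -> 'rV[R]_m.+1) : Prop :=
  [/\ smooth f, forall t, derive1 f t != 0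
    & forall s t, f s = f t <-> exists k : int, t = s + k%:~R].

(* An oriented link, as a parametrized submanifold of R^3. *)
Record link := Link {
  ncomp : nat;
  strand : 'I_ncomp -> R -> 'rV[R]_3;
  ncomp_gt0 : (0 < ncomp)%N;
  strand_closed : forall i, closed_curve (strand i);
  strand_disjoint : forall i j s t, strand i s = strand j t -> i = j }.

Definition homeomorphism (T : topologicalType) (f : T -> T) : Prop :=
  continuous f /\ exists g, [/\ continuous g, cancel f g & cancel g f].

(* Ambient isotopy of oriented links, up to the numbering and to the
   (orientation preserving) parametrization of the components. *)
Definition isotopic (L L' : link) : Prop :=
  exists H : R -> 'rV[R]_3 -> 'rV[R]_3,
  [/\ {within [set x : R * 'rV[R]_3 | 0 <= x.1 <= 1],
        continuous (fun x => H x.1 x.2)},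
      forall t, 0 <= t <= 1 -> homeomorphism (H t),
      H 0 = id
    & exists sigma : 'I_(ncomp L) -> 'I_(ncomp L'), bijective sigma /\
      forall i, exists phi : R -> R,
        [/\ continuous phi, {homo phi : s t / s < t},
            forall t, phi (t + 1) = phi t + 1
          & forall t, H 1 (strand i t) = strand (sigma i) (phi t)]].

(* The preimage under h of the unit sphere is a (tame) 2-sphere disjoint from
   the link, with components of the link on both sides. *)
Definition split_link (L : link) : Prop :=
  exists h : 'rV[R]_3 -> 'rV[R]_3, homeomorphism h /\
  let q p := \sum_k h p 0 k ^+ 2 in
  [/\ forall (i : 'I_(ncomp L)) t, q (strand i t) != 1,
      exists (i : 'I_(ncomp L)) t, q (strand i t) < 1
    & exists (i : 'I_(ncomp L)) t, 1 < q (strand i t)].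

(** * Diagrams *)

Notation plane := 'rV[R]_2.

(* Projection along the third coordinate, which points towards the viewer. *)
Definition proj (p : 'rV[R]_3) : plane := \row_k p 0 (widen_ord (leqnSn 2) k).
Definition height (p : 'rV[R]_3) : R := p 0 ord_max.

(* Positive if and only if v points to the left of u. *)
Definition cross (u v : plane) : R := u 0 0 * v 0 1 - u 0 1 * v 0 0.

(* U contains a germ at p of the open half line from p in the direction d. *)
Definition germ (p d : plane) (U : set plane) : Prop :=
  \forall e \near 0^'+, U (p + e *: d).

Section Diagram.
Variable D : link.
Implicit Types (i j : 'I_(ncomp D)) (s t : R) (p d : plane) (U : set plane).

Definition shadow i t : plane := proj (strand i t).
Definition velocity i t : plane := proj (derive1 (strand i) t).

Definition passes_over i t j s : Prop :=
  shadow i t = shadow j s /\ height (strand j s) < height (strand i t).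

Definition over i t : Prop := exists j s, passes_over i t j s.
Definition under i t : Prop := exists j s, passes_over j s i t.

Definition crossings : set plane :=
  [set p | exists i t, over i t /\ shadow i t = p].

(* The projection is an immersion whose only singularities are finitely many
   transverse double points. *)
Definition is_diagram : Prop :=
  [/\ forall i t, velocity i t != 0,
      forall i t j s, passes_over i t j s ->
        cross (velocity i t) (velocity j s) != 0,
      forall i1 t1 i2 t2 i3 t3,
        shadow i1 t1 = shadow i2 t2 -> shadow i2 t2 = shadow i3 t3 ->
        [\/ strand i1 t1 = strand i2 t2, strand i2 t2 = strand i3 t3
          | strand i1 t1 = strand i3 t3]
    & finite_set crossings].

(* Two passages through crossings that are consecutive along a component are
   not of the same kind. *)
Definition alternating_diagram : Prop :=
  forall i t t', t < t' ->
    (forall x, t < x < t' -> ~ over i x /\ ~ under i x) ->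
    ~ (over i t /\ over i t') /\ ~ (under i t /\ under i t').

(* A simple closed curve meets the diagram only at p, where it is transverse
   to both strands. *)
Definition nugatory p : Prop :=
  exists c : R -> plane,
  [/\ closed_curve c, c 0 = p, forall t i s, c t = shadow i s -> c t = p
    & forall i s, shadow i s = p -> cross (velocity i s) (derive1 c 0) != 0].

Definition reduced_diagram : Prop := forall p, crossings p -> ~ nugatory p.

Definition complement : set plane := [set p | forall i t, shadow i t <> p].

Definition region U : Prop :=
  exists2 p, complement p & U = connected_component complement p.

(* U and V lie on the two sides of the diagram at a point of an edge. *)
Definition share_edge (U V : set plane) : Prop :=
  exists i t d, [/\ ~ over i t, ~ under i t, cross (velocity i t) d != 0,
    germ (shadow i t) d U & germ (shadow i t) (- d) V].

(* U is one of the two regions swept at p when the over strand is rotated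
   counterclockwise until it reaches the under strand. *)
Definition swept p U : Prop :=
  exists i t j s, [/\ passes_over i t j s, shadow i t = p
    & let u := velocity i t in let v := velocity j s in
      let d := u + Num.sg (cross u v) *: v in
      germ p d U \/ germ p (- d) U].

(* The colour [true] is black. The black regions are the swept ones if the
   local rule is [b = true], and the other ones if [b = false]. *)
Definition checkerboard (b : bool) (chi : set plane -> bool) : Prop :=
  (forall U V, region U -> region V -> share_edge U V -> chi U != chi V) /\
  (forall p U, crossings p -> region U -> swept p U -> chi U = b).

(* U occupies one of the four corners at p. *)
Definition meets p U : Prop :=
  exists i t j s (a b : bool), [/\ passes_over i t j s, shadow i t = p
    & germ p ((-1) ^+ a *: velocity i t + (-1) ^+ b *: velocity j s) U].

Definition positive p : Prop :=
  exists i t j s, [/\ passes_over i t j s, shadow i t = p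
    & 0 < cross (velocity i t) (velocity j s)].

Definition wg p : Qwr := if `[< positive p >] then w else r.

Section Tait.
Variable chi : set plane -> bool.

(* A diagram has finitely many regions: [fset_set] is the set itself. *)
Definition tait_vertex (col : bool) : finType :=
  fset_sub_type (fset_set [set U | region U /\ chi U = col]).

Definition tait_ends (col : bool) p : {set tait_vertex col} :=
  finset (fun x : tait_vertex col => `[< meets p (val x) >]).

Definition tait_graph (col : bool) : wmultigraph (tait_vertex col) Qwr :=
  WMultigraph crossings (@tait_ends col) wg.

(* A reduced diagram has no loop in its Tait graphs, so that consolidation
   only merges parallel edges. *)
Definition ctait_graph (col : bool) : wgraph (tait_vertex col) Qwr :=
  consolidated (tait_graph col).

Definition CWR_diagram (k : nat) : Qwr * Qwr :=
  (cycle_sum (ctait_graph true) k, cycle_sum (ctait_graph false) k).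

End Tait.
End Diagram.

Definition alternating_link (L : link) : Prop :=
  exists D, [/\ isotopic D L, is_diagram D & alternating_diagram D].

Definition reduced_alternating_diagram_of (D L : link) : Prop :=
  [/\ isotopic D L, is_diagram D, alternating_diagram D & reduced_diagram D].

(* The known theorem that CWR_k(L) is well defined, for one link L. *)
Definition CWR_invariant (b : bool) (k : nat) (L : link) : Prop :=
  forall D D' chi chi',
    reduced_alternating_diagram_of D L -> checkerboard D b chi ->
    reduced_alternating_diagram_of D' L -> checkerboard D' b chi' ->
    CWR_diagram D chi k = CWR_diagram D' chi' k.

(* The common value of CWR_k on the reduced alternating diagrams of L. *)
Definition CWR_link (b : bool) (k : nat) (L : link) : Qwr * Qwr :=
  xget (0, 0) [set x | forall D chi,
    reduced_alternating_diagram_of D L -> checkerboard D b chi ->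
    CWR_diagram D chi k = x].

End Curves.

(* Main.v *)
(** A 5-cycle of the simple graph is traversed by exactly ten vertex sequences,
    so ten times the cycle sum is the sum of the weights of the closed 5-walks
    with distinct vertices. As the diagonal vanishes, such a walk can only
    repeat a vertex at the ends of a chord of the pentagon, and no two chords
    sharing an end can degenerate together. Inclusion-exclusion then leaves the
    empty set of chords, giving tr(M^5), the five single chords, each giving
    tr(Delta(M) M^3), and the five pairs of chords without a common end, each
    giving the trace of the Hadamard cube of M times M^2. *)
Require Import Defs.
From mathcomp Require Import all_boot all_order all_algebra.
From mathcomp Require Import all_classical all_reals all_analysis.
From mathcomp Require Import ring.
Import GRing.Theory.
Local Open Scope ring_scope.

Set Implicit Arguments.
Unset Strict Implicit.
Unset Printing Implicit Defensive.

(** * Vertex sequences with a given set of cycle edges *)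

Section CycleEdges.
Variable V : finType.
Implicit Types (s t : seq V) (x y : V).

Lemma next_next_neq s x :
  uniq s -> (2 < size s)%N -> x \in s -> next s (next s x) != x.
Proof.
move=> Us ks /rot_to[i p def_s]; rewrite -!(next_rot i Us).
move: Us ks; rewrite -(rot_uniq i) -(size_rot i s) def_s.
case: p {def_s} => [|y [|z p]] //= /andP[].
rewrite !inE !negb_or eqxx => /and3P[xy xz _] _ _.
by rewrite (eq_sym y x) (negbTE xy) eqxx eq_sym.
Qed.

Lemma traject_next x p :
  uniq (x :: p) -> x :: p = traject (next (x :: p)) x (size p).+1.
Proof.
move/cycle_next; rewrite /cycle rcons_path => /andP[/fpathE + _] /=.
by move=> {1}->.
Qed.

Lemma cycle_edge_mem s x y : [set x; y]%SET \in cycle_edges s -> x \in s.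
Proof.
case/imsetP=> z zs E; have := set21 x y; rewrite E !inE.
by case/orP=> /eqP->; rewrite ?mem_next.
Qed.

Lemma cycle_edgeP s x y :
  [set x; y]%SET \in cycle_edges s -> y = next s x \/ x = next s y.
Proof.
case/imsetP=> z _ E.
have : x \in [set z; next s z]%SET by rewrite -E set21.
have : y \in [set z; next s z]%SET by rewrite -E set22.
have : z \in [set x; y]%SET by rewrite E set21.
have : next s z \in [set x; y]%SET by rewrite E set22.
rewrite !inE.
do 4![case/orP=> /eqP ?]; by [left; congruence | right; congruence].
Qed.

(** Two vertices giving the same edge would be successors of each other, and two steps would lead
    back to the start, which takes a cycle of length at most 2. *)
Lemma cycle_edge_inj s : uniq s -> (2 < size s)%N ->
  {in s &, injective (fun x => [set x; next s x]%SET)}.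
Proof.
move=> Us ks x z xs zs E; apply/eqP/negPn/negP => xz.
have := set21 x (next s x); rewrite E !inE (negbTE xz) => /eqP xn.
have := set21 z (next s z); rewrite -E !inE eq_sym (negbTE xz) => /eqP zn.
by have := next_next_neq Us ks xs; rewrite -zn -xn eqxx.
Qed.

Lemma cycle_edges_rot i s : uniq s -> cycle_edges (rot i s) = cycle_edges s.
Proof.
move=> Us; apply/setP=> e; apply/imsetP/imsetP => -[x xs ->]; exists x;
  by rewrite ?next_rot ?mem_rot // -(mem_rot i).
Qed.

Lemma cycle_edges_rev s : uniq s -> cycle_edges (rev s) = cycle_edges s.
Proof.
have sub t : uniq t -> cycle_edges (rev t) \subset cycle_edges t.
  move=> Ut; apply/fintype.subsetP=> e /imsetP[x]; rewrite mem_rev => xt ->.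
  apply/imsetP; exists (prev t x); first by rewrite mem_prev.
  by rewrite next_rev // next_prev // finset.setUC.
move=> Us; apply/eqP; rewrite finset.eqEsubset sub //=.
by rewrite -{1}(revK s) sub ?rev_uniq.
Qed.

(* The two cycles agree on one arc, hence step by step: from there, [t] can only
   go on like [s] or turn back. *)
Lemma eq_iter_next s t x : uniq s -> uniq t -> (2 < size t)%N ->
    cycle_edges t = cycle_edges s -> x \in t -> next t x = next s x ->
  forall i, iter i (next t) x = iter i (next s) x.
Proof.
move=> Us Ut kt E xt nx i.
have iter_t j : iter j (next t) x \in t.
  by elim: j => //= j IHj; rewrite mem_next.
(* The induction also carries the agreement of both successors at the current vertex. *)
suff [] : iter i (next t) x = iter i (next s) x
  /\ next t (iter i (next t) x) = next s (iter i (next t) x) by [].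
elim: i => [|i [IH1 IH2]] //; split; first by rewrite !iterS IH2 IH1.
rewrite iterS; set y := iter i (next t) x in IH2 *.
have yt : y \in t by exact: iter_t.
have: [set next t y; next t (next t y)]%SET \in cycle_edges s.
  by rewrite -E; apply/imsetP; exists (next t y); rewrite ?mem_next.
case/cycle_edgeP=> [//|F].
have/(can_inj (prev_next Us)) Ey : next s y = next s (next t (next t y)).
  by rewrite -F -IH2.
by have := next_next_neq Ut kt yt; rewrite -Ey eqxx.
Qed.

(** Once [s] is rotated to start at [x], both sequences are trajectories from [x] under their
    successor maps, which agree along the way by [eq_iter_next]. *)
Lemma eq_next_rot s t x : uniq s -> uniq t -> size s = size t ->
    (2 < size t)%N -> cycle_edges t = cycle_edges s -> x \in t -> x \in s ->
  next t x = next s x -> head x t = x -> exists2 i, (i < size s)%N & t = rot i s.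
Proof.
move=> Us Ut kst kt E xt xs nx hx; exists (index x s); first by rewrite index_mem.
have Er := rot_index xs; set p := _ ++ _ in Er.
have Ur : uniq (x :: p) by rewrite -Er rot_uniq.
have kp : (size p).+1 = size t by rewrite -kst -(size_rot (index x s) s) Er.
case: t Ut kst kt E xt nx hx kp => // y q Ut kst kt E xt nx /= hx kp; subst y.
case: kp => kp.
rewrite Er (traject_next Ut) (traject_next Ur) kp.
have nE : next (x :: p) =1 next s by move=> z; rewrite -Er next_rot.
apply: (@eq_from_nth _ x); rewrite !size_traject // => i ik.
rewrite !nth_traject // (eq_iter_next Us Ut kt E xt nx).
by apply/esym/eq_iter.
Qed.

(** The first edge of [t] is an edge of [s], traversed forwards or backwards; reversing [s] reduces
    the second case to the first. *)
Lemma eq_cycle_edges_rot s t : uniq s -> uniq t -> size s = size t ->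
    (2 < size t)%N -> cycle_edges t = cycle_edges s ->
  exists i b, (i < size s)%N /\ t = rot i (if b then rev s else s).
Proof.
move=> Us Ut kst kt E.
have [x [xt hx]] : exists x, x \in t /\ head x t = x.
  by case: t kt {Ut kst E} => // x t _; exists x; rewrite mem_head.
have edge : [set x; next t x]%SET \in cycle_edges s.
  by rewrite -E; apply/imsetP; exists x.
have xs := cycle_edge_mem edge.
case: (cycle_edgeP edge) => nx.
  have [i ik ->] := eq_next_rot Us Ut kst kt E xt xs nx hx.
  by exists i, false.
have [] := @eq_next_rot (rev s) t x; rewrite ?rev_uniq ?size_rev ?mem_rev //.
- by rewrite cycle_edges_rev.
- by rewrite next_rev // {2}nx prev_next.
by move=> i ik ->; exists i, true.
Qed.

Lemma card_cycle_edges_fiber k (s : k.-tuple V) : uniq s -> (2 < k)%N ->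
  #|[pred t : k.-tuple V | uniq t & cycle_edges t == cycle_edges s]| = (2 * k)%N.
Proof.
move=> Us k2; have ks := size_tuple s.
pose g (u : 'I_k * bool) : k.-tuple V :=
  [tuple of rot u.1 (if u.2 then [tuple of rev s] else s)].
have gE u : g u = rot u.1 (if u.2 then rev s else s) :> seq V.
  by rewrite /g; case: u => i [].
have Ub (b : bool) : uniq (if b then rev s else s) by case: b; rewrite ?rev_uniq.
have g_inj : injective g.
  move=> [i b] [j c] E.
  have {}E : g (i, b) = g (j, c) :> seq V by rewrite E.
  rewrite !gE /= in E.
  (* Rotation preserves successors, whereas reversal swaps them with predecessors; these differ
     because [2 < k]. *)
  have bc : b = c.
    have [x xs] : exists x, x \in (s : seq V).
      by case: (s : seq V) ks k2 => [<-//|x p _ _]; exists x; rewrite mem_head.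
    have next_prev_neq : next s x <> prev s x.
      move=> F; have := @next_next_neq s x Us; rewrite ks F next_prev // eqxx.
      by move/(_ k2 xs).
    have : next (if b then rev s else s) x = next (if c then rev s else s) x.
      by rewrite -(next_rot i (Ub b)) E next_rot.
    by case: b c {E} => -[] //; rewrite next_rev // => F; case: next_prev_neq.
  subst c; congr (_, _); apply: val_inj => /=.
  set q := if b then _ else _ in E.
  have kq : size q = k by rewrite /q; case: (b); rewrite ?size_rev.
  have [x0 _] : exists x : V, true.
    by case: (s : seq V) ks k2 => [<-//|x p _ _]; exists x.
  (* The head of a rotation of the duplicate-free [q] determines the shift. *)
  have nth_rot0 (l : 'I_k) : nth x0 (rot l q) 0 = nth x0 q l.
    by rewrite /rot nth_cat size_drop kq subn_gt0 ltn_ord nth_drop addn0.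
  apply/eqP; rewrite -(nth_uniq x0 _ _ (Ub b)) -/q ?kq //.
  by rewrite -!nth_rot0 E.
have -> : (2 * k = #|{: 'I_k * bool}|)%N.
  by rewrite card_prod card_ord card_bool mulnC.
rewrite -(card_codom g_inj); apply: eq_card => t; rewrite !inE.
apply/andP/codomP => [[Ut /eqP E]|[[i b] ->]].
  have := eq_cycle_edges_rot Us Ut; rewrite !size_tuple => /(_ erefl k2 E).
  case=> i [b [ik tE]]; exists (Ordinal ik, b).
  by apply: val_inj; rewrite /= tE; case: (b).
rewrite gE rot_uniq /= Ub cycle_edges_rot ?Ub //.
by case: b; rewrite ?cycle_edges_rev.
Qed.

End CycleEdges.

(** * Sums over five indices *)

Definition sum5 (V : finType) (K : nmodType) (F : V -> V -> V -> V -> V -> K) : K :=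
  \sum_a \sum_b \sum_c \sum_d \sum_e F a b c d e.

Section Sum5.
Variable V : finType.

Lemma eq_sum5 (K : nmodType) (F G : V -> V -> V -> V -> V -> K) :
  (forall a b c d e, F a b c d e = G a b c d e) -> sum5 F = sum5 G.
Proof. by move=> FG; do 5![apply: eq_bigr => ? _]. Qed.

Lemma sum5_rot (K : nmodType) (F : V -> V -> V -> V -> V -> K) :
  sum5 (fun a b c d e => F b c d e a) = sum5 F.
Proof.
rewrite /sum5 exchange_big; apply: eq_bigr => b _.
rewrite exchange_big; apply: eq_bigr => c _.
rewrite exchange_big; apply: eq_bigr => d _.
by rewrite exchange_big.
Qed.

Lemma sum5D (K : nmodType) (F G : V -> V -> V -> V -> V -> K) :
  sum5 (fun a b c d e => F a b c d e + G a b c d e) = sum5 F + sum5 G.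
Proof.
rewrite /sum5 -big_split; apply: eq_bigr => a _.
rewrite -big_split; apply: eq_bigr => b _.
rewrite -big_split; apply: eq_bigr => c _.
by rewrite -big_split; apply: eq_bigr => d _; rewrite -big_split.
Qed.

Lemma sum5N (K : zmodType) (F : V -> V -> V -> V -> V -> K) :
  sum5 (fun a b c d e => - F a b c d e) = - sum5 F.
Proof.
rewrite /sum5 -sumrN; apply: eq_bigr => a _.
rewrite -sumrN; apply: eq_bigr => b _; rewrite -sumrN; apply: eq_bigr => c _.
by rewrite -sumrN; apply: eq_bigr => d _; rewrite -sumrN.
Qed.

Lemma sum_tuple_cons (K : nmodType) n (F : n.+1.-tuple V -> K) :
  \sum_s F s = \sum_a \sum_(t : n.-tuple V) F [tuple of a :: t].
Proof.
rewrite pair_big /=.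
apply: (reindex (fun p : V * n.-tuple V => [tuple of p.1 :: p.2])).
exists (fun s => (thead s, [tuple of behead s])) => [[a t]|s] _ /=.
  by rewrite theadE; congr (_, _); apply: val_inj.
by rewrite -tuple_eta.
Qed.

Lemma sum_tuple5 (K : nmodType) (F : seq V -> K) :
  \sum_(s : 5.-tuple V) F s = sum5 (fun a b c d e => F [:: a; b; c; d; e]).
Proof.
do 5![rewrite sum_tuple_cons; apply: eq_bigr => ? _].
by rewrite (big_pred1 [tuple]) // => t; apply/esym/eqP; rewrite tuple0.
Qed.

Lemma sum5_enum_val (K : nmodType) (F : V -> V -> V -> V -> V -> K) :
  sum5 F = sum5 (fun a b c d e : 'I_#|V| =>
    F (enum_val a) (enum_val b) (enum_val c) (enum_val d) (enum_val e)).
Proof. by do 5![rewrite /sum5 big_enum_val; apply: eq_bigr => ? _]. Qed.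

End Sum5.

(** * Closed 5-walks and their degenerations as traces *)

Section ClosedWalks.
Variables (K : comNzRingType) (n : nat) (M : 'M[K]_n).

Definition walk5 a b c d e := M a b * (M b c * (M c d * (M d e * M e a))).

Lemma expmx2E i j : (M ^+ 2) i j = \sum_k M i k * M k j.
Proof. by rewrite expr2 mxE. Qed.

Lemma expmx3E i j : (M ^+ 3) i j = \sum_k \sum_l M i k * (M k l * M l j).
Proof.
rewrite exprS mxE; apply: eq_bigr => k _.
by rewrite expmx2E mulr_sumr.
Qed.

Lemma trmx5E : \tr (M ^+ 5) = sum5 walk5.
Proof.
apply: eq_bigr => a _; rewrite exprS mxE; apply: eq_bigr => b _.
rewrite exprS mxE mulr_sumr; apply: eq_bigr => c _.
rewrite expmx3E !mulr_sumr; apply: eq_bigr => d _.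
by rewrite !mulr_sumr.
Qed.

(** The weight of a closed walk is invariant under rotation, so one chord, or one pair of chords,
    can stand for all five of its rotations. *)
Lemma sum5_walk_rot P :
  sum5 (fun a b c d e => walk5 a b c d e * P b c d e a)
    = sum5 (fun a b c d e => walk5 a b c d e * P a b c d e).
Proof.
rewrite -[RHS]sum5_rot; apply: eq_sum5 => a b c d e.
by congr (_ * _); rewrite /walk5; ring.
Qed.

Hypothesis M_sym : forall i j, M i j = M j i.
Hypothesis M_diag : forall i, M i i = 0.

(** If a = c, the walk goes to b and back, contributing the square of [M a b] by symmetry, and then
    closes up at a in three steps. *)
Lemma mxtrace_Delta :
  \tr (Delta M *m M ^+ 3)
    = sum5 (fun a b c d e => walk5 a b c d e * (a == c)%:R).
Proof.
apply: eq_bigr => a _; rewrite mul_diag_mx mxE [X in X * _]mxE mulr_suml.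
apply: eq_bigr => b _; rewrite (bigD1 a) //= [X in _ + X]big1 ?addr0 => [|c].
  rewrite expmx3E mulr_sumr; apply: eq_bigr => d _; rewrite mulr_sumr.
  by apply: eq_bigr => e _; rewrite eqxx mulr1 /walk5 (M_sym b a); ring.
rewrite eq_sym => /negbTE ac; apply: big1 => d _; apply: big1 => e _.
by rewrite ac mulr0.
Qed.

(** If a = c and b = d, the edge ab is traversed three times, and two steps through e lead from b
    back to a. *)
Lemma mxtrace_hadamard_cube :
  \tr (hadamard_cube M *m M ^+ 2)
    = sum5 (fun a b c d e => walk5 a b c d e * ((a == c)%:R * (b == d)%:R)).
Proof.
apply: eq_bigr => a _; rewrite mxE; apply: eq_bigr => b _.
rewrite (bigD1 a) //= [X in _ + X]big1 ?addr0 => [|c].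
  rewrite (bigD1 b) //= [X in _ + X]big1 ?addr0 => [|d].
    rewrite expmx2E mxE mulr_sumr; apply: eq_bigr => e _.
    by rewrite !eqxx !mulr1 /walk5 (M_sym b a); ring.
  rewrite eq_sym => /negbTE bd; apply: big1 => e _.
  by rewrite bd !mulr0.
rewrite eq_sym => /negbTE ac; apply: big1 => d _; apply: big1 => e _.
by rewrite ac mul0r mulr0.
Qed.

Lemma walk5_uniq a b c d e :
  (if uniq [:: a; b; c; d; e] then walk5 a b c d e else 0) =
    walk5 a b c d e - walk5 a b c d e * (a == c)%:R
    - walk5 a b c d e * (b == d)%:R - walk5 a b c d e * (c == e)%:R
    - walk5 a b c d e * (d == a)%:R - walk5 a b c d e * (e == b)%:R
    + walk5 a b c d e * ((a == c)%:R * (b == d)%:R)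
    + walk5 a b c d e * ((b == d)%:R * (c == e)%:R)
    + walk5 a b c d e * ((c == e)%:R * (d == a)%:R)
    + walk5 a b c d e * ((d == a)%:R * (e == b)%:R)
    + walk5 a b c d e * ((e == b)%:R * (a == c)%:R).
Proof.
(* A walk of nonzero weight has distinct consecutive vertices, by the zero diagonal. *)
case: (eqVneq (walk5 a b c d e) 0) => [->|W0]; first by case: ifP => _; ring.
have neq i j : M i j != 0 -> i == j = false.
  by apply: contraNF => /eqP->; rewrite M_diag.
have [ab bc cd de ea] :
    [/\ a == b = false, b == c = false, c == d = false, d == e = false
      & e == a = false].
  by split; apply: neq; apply: contraNneq W0 => E; rewrite /walk5 E ?(mul0r, mulr0).
rewrite /= !inE (eq_sym a e) (eq_sym a d) (eq_sym b e) ab bc cd de ea.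
(* Among the 32 patterns of degenerate chords, [ring] settles all the possible ones; any pattern it
   leaves has two chords with a common end, which identifies consecutive vertices. *)
case: (a =P c) => [ac|_]; case: (b =P d) => [bd|_]; case: (c =P e) => [ce|_];
  case: (d =P a) => [da|_]; case: (e =P b) => [eb|_] /=; try (by ring);
  by subst; move: ab bc cd de ea; rewrite ?eqxx.
Qed.

Lemma sum5_uniq_walk :
  sum5 (fun a b c d e => if uniq [:: a; b; c; d; e] then walk5 a b c d e else 0)
    = \tr (M ^+ 5) - 5%:R * \tr (Delta M *m M ^+ 3)
      + 5%:R * \tr (hadamard_cube M *m M ^+ 2).
Proof.
rewrite (eq_sum5 walk5_uniq) !(sum5D, sum5N) -trmx5E.
rewrite mxtrace_Delta mxtrace_hadamard_cube.
set P1 := fun a b c d e : 'I_n => (a == c)%:R : K.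
set P2 := fun a b c d e : 'I_n => (a == c)%:R * (b == d)%:R : K.
have E1 := sum5_walk_rot P1.
have E2 := sum5_walk_rot (fun a b c d e => P1 b c d e a).
have E3 := sum5_walk_rot (fun a b c d e => P1 c d e a b).
have E4 := sum5_walk_rot (fun a b c d e => P1 d e a b c).
have F1 := sum5_walk_rot P2.
have F2 := sum5_walk_rot (fun a b c d e => P2 b c d e a).
have F3 := sum5_walk_rot (fun a b c d e => P2 c d e a b).
have F4 := sum5_walk_rot (fun a b c d e => P2 d e a b c).
rewrite /P1 /P2 /= in E1 E2 E3 E4 F1 F2 F3 F4.
(* Each equation undoes one rotation, so the most rotated terms are rewritten first. *)
rewrite E4 E3 E2 E1 F4 F3 F2 F1.
by ring.
Qed.

End ClosedWalks.

(** * Cycle sums as sums over vertex sequences *)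

Section CycleSum.
Variables (V : finType) (K : comNzRingType) (G : wgraph V K).

Definition weight x y : K :=
  if Defs.adjacent G x y then sg_weight G [set x; y]%SET else 0.

Lemma cycle_adjacent (s : seq V) :
  uniq s -> cycle (Defs.adjacent G) s = (cycle_edges s \subset sg_edges G).
Proof.
move=> Us; apply/idP/fintype.subsetP => [cs e /imsetP[x xs ->]|sub].
  exact: next_cycle cs xs.
by apply: cycle_from_next => // x xs; apply: sub; apply/imsetP; exists x.
Qed.

(** A missing edge contributes a factor 0; otherwise distinct vertices give distinct edges, and the
    product can be taken over the edge set. *)
Lemma prod_weight (s : seq V) : uniq s -> (2 < size s)%N ->
  \prod_(x <- s) weight x (next s x) =
    if cycle (Defs.adjacent G) s
    then \prod_(e in cycle_edges s) sg_weight G e else 0.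
Proof.
move=> Us ks; case: ifPn => [cs|ncs].
  rewrite big_imset /=; last exact: cycle_edge_inj.
  rewrite big_uniq //; apply: eq_bigr => x xs.
  by rewrite /weight (next_cycle cs xs).
have [/allP adj|/allPn[x xs nadj]] :=
  boolP (all (fun x => Defs.adjacent G x (next s x)) s).
  by case/negP: ncs; apply: cycle_from_next.
by rewrite (big_rem x xs) /= /weight (negbTE nadj) mul0r.
Qed.

(** The sequences are grouped by edge set, each cycle accounting for [2 * k] of them. *)
Lemma cycle_sum_tuples k : (2 < k)%N ->
  (2 * k)%:R * cycle_sum G k =
    \sum_(s : k.-tuple V) if uniq s then \prod_(x <- s) weight x (next s x) else 0.
Proof.
move=> k2; rewrite -big_mkcond /=.
pose wt (C : {set {set V}}) := \prod_(e in C) sg_weight G e.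
pose P := [pred s : k.-tuple V | uniq s && cycle (Defs.adjacent G) s].
have -> : \sum_(s : k.-tuple V | uniq s) \prod_(x <- s) weight x (next s x)
          = \sum_(s | P s) wt (cycle_edges s).
  rewrite big_mkcondr; apply: eq_bigr => s Us.
  by rewrite prod_weight ?size_tuple.
rewrite (partition_big (fun s : k.-tuple V => cycle_edges s)
  (mem (simple_cycles G k))).
  rewrite /cycle_sum mulr_sumr; apply: eq_bigr => C.
  rewrite inE => /existsP[s /and3P[Us cs /eqP ->]].
  rewrite [RHS](eq_bigr (fun=> wt (cycle_edges s))); last first.
    by move=> t /andP[_ /eqP->].
  rewrite sumr_const -(card_cycle_edges_fiber Us k2) mulr_natl.
  congr (_ *+ _); apply: eq_card => t; rewrite [LHS]inE [RHS]inE /= -andbA.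
  (* Being a cycle of [G] depends only on the edge set, so it holds throughout the fibre of [s]. *)
  case Ut: (uniq t) => //=; rewrite cycle_adjacent //.
  by case: eqP => [->|]; rewrite ?andbF // -cycle_adjacent // cs.
move=> s /andP[Us cs]; suff: cycle_edges s \in simple_cycles G k by [].
by rewrite inE; apply/existsP; exists s; rewrite Us cs eqxx.
Qed.

Lemma cycle_sum5 :
  10%:R * cycle_sum G 5 =
    sum5 (fun a b c d e => if uniq [:: a; b; c; d; e] then
      weight a b * (weight b c * (weight c d * (weight d e * weight e a))) else 0).
Proof.
rewrite (@cycle_sum_tuples 5) //.
rewrite (sum_tuple5 (fun s =>
  if uniq s then \prod_(x <- s) weight x (next s x) else 0)).
apply: eq_sum5 => a b c d e; case: ifP => // /=.
rewrite !inE !negb_or -!andbA.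
case/and5P=> ab ac ad ae /and5P[bc bd be cd] /andP[ce /andP[de _]].
rewrite !big_cons big_nil mulr1 /= !eqxx.
have neqC (x y : V) : x != y -> (y == x) = false by rewrite eq_sym => /negbTE.
rewrite !(neqC _ _ ab, neqC _ _ ac, neqC _ _ ad, neqC _ _ ae, neqC _ _ bc) /=.
by rewrite !(neqC _ _ bd, neqC _ _ be, neqC _ _ cd, neqC _ _ ce, neqC _ _ de).
Qed.

Lemma adjmxE i j : adjmx G i j = weight (enum_val i) (enum_val j).
Proof. by rewrite mxE. Qed.

Lemma weight_sym x y : weight x y = weight y x.
Proof. by rewrite /weight /Defs.adjacent finset.setUC. Qed.

Lemma weight_diag x : weight x x = 0.
Proof.
by rewrite /weight; case: ifP => // /sg_edgesP; rewrite finset.setUid cards1.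
Qed.

Lemma cycle_sum5_adjmx :
  let M := adjmx G in
  10%:R * cycle_sum G 5 = \tr (M ^+ 5) - 5%:R * \tr (Delta M *m M ^+ 3)
    + 5%:R * \tr (hadamard_cube M *m M ^+ 2).
Proof.
move=> M; rewrite -sum5_uniq_walk => [|i j|i]; last first.
- by rewrite adjmxE weight_diag.
- by rewrite !adjmxE weight_sym.
rewrite cycle_sum5 sum5_enum_val; apply: eq_sum5 => a b c d e.
by rewrite -(map_inj_uniq enum_val_inj) /walk5 !adjmxE.
Qed.

End CycleSum.

(** * The formula for [Phi5] and its application to links *)

Lemma cycle_sum5_Phi5 (V : finType) (K : comAlgType rat) (G : wgraph V K) :
  cycle_sum G 5 = Phi5 (adjmx G).
Proof.
(* The factor 10 becomes a rational scalar, which can be inverted. *)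
rewrite /Phi5 -cycle_sum5_adjmx mulr_natl -scaler_nat scalerA.
by rewrite mulVf // scale1r.
Qed.

(** The trace of a product pairs the entry (i, j) of one factor with (j, i) of the other; symmetry
    of [M ^+ 2] exchanges the latter indices. *)
Lemma Phi5_entriesE (K : comAlgType rat) n (M : 'M[K]_n) :
  M^T = M -> Phi5 M = Phi5_entries M.
Proof.
move=> sM; have sM2 : (M ^+ 2)^T = M ^+ 2 by rewrite expr2 trmx_mul sM.
rewrite /Phi5 /Phi5_entries; congr (_ *: (_ - _ * _ + _ * _)).
  apply: eq_bigr => i _; rewrite mul_diag_mx mxE [X in X * _]mxE //.
apply: eq_bigr => i _; rewrite mxE; apply: eq_bigr => j _.
rewrite [X in X * _]mxE; congr (_ * _).
by rewrite -[in LHS]sM2 mxE.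
Qed.

Theorem theorem6p5 (R : realType) (b : bool) (L : link R)
    (hsplit : ~ split_link L) (halt : alternating_link L)
    (D : link R) (hD : reduced_alternating_diagram_of D L)
    (chi : set 'rV[R]_2 -> bool) (hchi : checkerboard D b chi) :
  let A_B := adjmx (ctait_graph D chi true) in
  let A_W := adjmx (ctait_graph D chi false) in
  [/\ CWR_diagram D chi 5 = (Phi5 A_B, Phi5 A_W),
      CWR_invariant b 5 L -> CWR_link b 5 L = (Phi5 A_B, Phi5 A_W)
    & forall (n : nat) (M : 'M[Qwr]_n), M^T = M -> (forall i, M i i = 0) ->
        Phi5 M = Phi5_entries M].
Proof.
move=> A_B A_W.
have CWR_D : CWR_diagram D chi 5 = (Phi5 A_B, Phi5 A_W).
  by rewrite /CWR_diagram !cycle_sum5_Phi5.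
split=> // [inv|n M sM _]; last exact: Phi5_entriesE.
(* Invariance makes the value on [D] a common value, and [D] itself makes it the only one, so [xget]
   does not fall back on its default. *)
rewrite -CWR_D /CWR_link; apply: xget_unique => [D' chi' hD' hchi'|x hx].
  exact: inv hD' hchi' hD hchi.
by rewrite (hx _ _ hD hchi).
Qed.
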